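(* Let $V=\mathbb{F}_2^n$ with $n\ge 3$, and identify the anti-flags of $\mathrm{PG}(n-1,2)$ with the non-singular points of the quadratic form $Q$ on $V\times V^*$ via the bijection $f$ described below. Then the hyperbolic polar space $\mathcal{O}^+(2n,2)$ (its singular points and singular lines) can be recovered from the graph $\Gamma_1$; in particular every automorphism of $\Gamma_1$ induces an automorphism of the polar space $\mathcal{O}^+(2n,2)$.
   Context: An anti-flag of $\mathrm{PG}(n-1,2)$ is a pair $(p,H)$ of a point $p$ and a hyperplane $H$ with $p\notin H$. For distinct anti-flags, $(p_1,H_1)\sim_1(p_2,H_2)$ iff $p_j\in H_{3-j}$ and $p_{3-j}\notin H_j$ for some $j\in\{1,2\}$; $\Gamma_1$ is the graph on anti-flags with adjacency $\sim_1$. On $W=V\times V^*$ define $Q(x,x^* )=x^*(x)$ (a non-degenerate hyperbolic quadratic form). A point $\langle w\rangle$ of $\mathrm{PG}(2n-1,2)$ is singular if $Q(w)=0$ and non-singular otherwise. The map $f:\langle(x,x^* )\rangle\mapsto(\langle x\rangle,\ker x^* )$ is a bijection from non-singular points to anti-flags. The polar space $\mathcal{O}^+(2n,2)$ is the point-line geometry of singular points and singular lines (lines all of whose points are singular); its automorphisms are permutations of singular points mapping singular lines to singular lines. *)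

(* Defs.v *)
From HB Require Import structures.
From mathcomp Require Import all_boot all_order all_algebra all_fingroup.

Set Implicit Arguments.
Unset Strict Implicit.
Unset Printing Implicit Defensive.

Import GRing.Theory.
Local Open Scope ring_scope.

(* MathComp's product of two finite modules is not declared a finite module. *)
HB.instance Definition _ (R : finNzRingType) (U U' : finLmodType R) :=
  GRing.Lmodule.on (U * U')%type.

(* Subspaces are represented by their finite sets of vectors, so that points,
   lines and hyperplanes are again elements of finite types. *)
Section ProjectiveSpace.
Variable U : finLmodType 'F_2.

Definition pspan (u : U) : {set U} := [set k *: u | k : 'F_2].

Definition is_point (p : {set U}) : bool :=
  [exists u : U, (u != 0) && (p == pspan u)].

Definition join (p q : {set U}) : {set U} := [set u + v | u in p, v in q].

Definition is_line (l : {set U}) : bool :=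
  [exists p : {set U}, exists q : {set U},
    [&& is_point p, is_point q, p != q & l == join p q]].

Lemma pspanE (u : U) : pspan u = [set 0; u].
Proof.
apply/setP=> x; rewrite !inE; apply/imsetP/orP.
  case=> k _ ->; case: k => [[|[|//]] lt_k].
    by left; rewrite (_ : Ordinal _ = 0) ?scale0r //; apply: val_inj.
  by right; rewrite (_ : Ordinal _ = 1) ?scale1r //; apply: val_inj.
by case=> /eqP->; [exists 0; rewrite ?scale0r | exists 1; rewrite ?scale1r].
Qed.

End ProjectiveSpace.

Section AntiFlags.
Variable n : nat.

(* The dual V^* is the space of column vectors, a column y being the functional
   x |-> x *m y. *)
Notation V := 'rV['F_2]_n.
Notation Vd := 'cV['F_2]_n.
Notation W := (V * Vd)%type.

Definition app (y : Vd) (x : V) : 'F_2 := (x *m y) 0 0.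

Definition fker (y : Vd) : {set V} := [set x | app y x == 0].

Definition is_hyperplane (H : {set V}) : bool :=
  [exists y : Vd, (y != 0) && (H == fker y)].

Definition is_antiflag (a : {set V} * {set V}) : bool :=
  [&& is_point a.1, is_hyperplane a.2 & ~~ (a.1 \subset a.2)].

Definition antiflag : Type := {a : {set V} * {set V} | is_antiflag a}.
HB.instance Definition _ := SubFinite.on antiflag.

Definition adj1 (a b : antiflag) : bool :=
  (a != b) &&
  (((val a).1 \subset (val b).2) && ~~ ((val b).1 \subset (val a).2) ||
   ((val b).1 \subset (val a).2) && ~~ ((val a).1 \subset (val b).2)).

Definition Q (w : W) : 'F_2 := app w.2 w.1.

Definition singular (s : {set W}) : bool :=
  [exists w : W, [&& w != 0, s == pspan w & Q w == 0]].

Definition nonsingular (s : {set W}) : bool := is_point s && ~~ singular s.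

Definition sing_point : Type := {s : {set W} | singular s}.
HB.instance Definition _ := SubFinite.on sing_point.

Definition nonsing_point : Type := {s : {set W} | nonsingular s}.
HB.instance Definition _ := SubFinite.on nonsing_point.

Definition is_singular_line (l : {set W}) : bool :=
  is_line l &&
  [forall p : {set W}, is_point p && (p \subset l) ==> singular p].

Definition singular_lines : {set {set sing_point}} :=
  [set [set s : sing_point | val s \subset l] | l : {set W} & is_singular_line l].

(* f without choosing a representative of the point: for s = <(x, x^* )> this is
   (<x>, ker x^* ), see [fmap_pspan]. *)
Definition fmap (s : {set W}) : {set V} * {set V} :=
  ([set w.1 | w in s], \bigcap_(w in s) fker w.2).

Lemma fmap_pspan (x : V) (y : Vd) :
  fmap (pspan ((x, y) : W)) = (pspan x, fker y).
Proof.
rewrite /fmap !pspanE; congr pair.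
  by rewrite imsetU1 imset_set1.
apply/setP=> z; apply/bigcapP/idP => [/(_ (x, y))|zy w].
  by apply; rewrite !inE eqxx orbT.
rewrite !inE => /orP[] /eqP-> //=; last by move: zy; rewrite inE.
by rewrite /app mulmx0 mxE.
Qed.

Lemma F2_neq0 (k : 'F_2) : k != 0 -> k = 1.
Proof. by case: k => [[|[|//]] lt_k] // _; apply: val_inj. Qed.

Lemma pspan_inj (U : finLmodType 'F_2) : injective (@pspan U).
Proof.
move=> u v; rewrite !pspanE => /setP uv.
have := uv u; have := uv v; rewrite !inE !eqxx !orbT.
case/orP=> /eqP-> //; rewrite ?eqxx // orbb.
by move/esym/eqP.
Qed.

Lemma nonsingularP (s : {set W}) :
  reflect (exists2 w : W, s = pspan w & Q w = 1) (nonsingular s).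
Proof.
apply: (iffP andP) => [[/existsP[w /andP[w0 /eqP sw]] ns]|[w -> Qw]].
  exists w => //; apply: F2_neq0; apply: contra ns => Qw.
  by apply/existsP; exists w; rewrite w0 sw eqxx.
have w0 : w != 0.
  by apply/eqP=> w0; move: Qw; rewrite w0 /Q /app mulmx0 mxE => /eqP; rewrite eq_sym oner_eq0.
split; first by apply/existsP; exists w; rewrite w0 eqxx.
apply/negP=> /existsP[w' /and3P[_ /eqP/pspan_inj <-]].
by rewrite Qw oner_eq0.
Qed.

Lemma pspan_sub_fker (x : V) (y : Vd) : (pspan x \subset fker y) = (app y x == 0).
Proof.
rewrite pspanE subUset !sub1set !inE /app mul0mx mxE eqxx //.
Qed.

Lemma fker_inj : injective fker.
Proof.
move=> y z /setP yz; apply/matrixP=> i j; rewrite ord1.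
have := yz (delta_mx 0 i); rewrite !inE /app -!rowE !mxE.
case: (eqVneq (y i 0) 0) => [-> /esym/eqP-> //|y0].
by move/esym/negbT=> z0; rewrite (F2_neq0 y0) (F2_neq0 z0).
Qed.

Lemma fmap_antiflag (s : {set W}) : nonsingular s -> is_antiflag (fmap s).
Proof.
case/nonsingularP=> [[x y] -> Qxy]; rewrite fmap_pspan /is_antiflag /=.
rewrite /Q /= in Qxy; rewrite pspan_sub_fker Qxy oner_eq0 andbT.
apply/andP; split; apply/existsP; [exists x | exists y]; rewrite eqxx andbT.
- by apply/eqP=> x0; move: Qxy; rewrite x0 /app mul0mx mxE => /eqP; rewrite eq_sym oner_eq0.
- by apply/eqP=> y0; move: Qxy; rewrite y0 /app mulmx0 mxE => /eqP; rewrite eq_sym oner_eq0.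
Qed.

Definition f (s : nonsing_point) : antiflag :=
  exist _ (fmap (val s)) (fmap_antiflag (valP s)).

Lemma f_bij : bijective f.
Proof.
have f_inj : injective f.
  move=> [s ns] [t nt] /(congr1 val) eq_st; apply: val_inj => /=.
  have {eq_st} : fmap s = fmap t by [].
  case/nonsingularP: ns => -[x y] -> _; case/nonsingularP: nt => -[x' y'] -> _.
  by rewrite !fmap_pspan => -[/pspan_inj-> /fker_inj->].
have f_surj (a : antiflag) : exists s, f s == a.
  case/and3P: (valP a) => /existsP[x /andP[_ /eqP ax]].
  case/existsP=> y /andP[_ /eqP ay]; rewrite ax ay pspan_sub_fker => /F2_neq0 Qxy.
  have ns : nonsingular (pspan ((x, y) : W)) by apply/nonsingularP; exists (x, y).
  exists (exist (fun s => nonsingular s) _ ns); apply/eqP/val_inj.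
  rewrite [LHS](_ : _ = fmap (pspan ((x, y) : W))) // fmap_pspan -ax -ay.
  by case: (val a).
exists (fun a => xchoose (f_surj a)) => [s|a]; last exact/eqP/(xchooseP (f_surj a)).
by apply: f_inj; apply/eqP/(xchooseP (f_surj (f s))).
Qed.

(* The lines of PG(2n-1,2) through s containing two non-singular points, each
   given by the pair of anti-flags identified with these two points. *)
Definition pencil (s : sing_point) : {set {set antiflag}} :=
  [set [set f u.1; f u.2] | u : nonsing_point * nonsing_point
     & (u.1 != u.2) && (val s \subset join (val u.1) (val u.2))].

Definition graph_aut (g : {perm antiflag}) : Prop :=
  forall a b : antiflag, adj1 (g a) (g b) = adj1 a b.

Definition polar_aut (phi : {perm sing_point}) : Prop :=
  forall l : {set sing_point},
    l \in singular_lines -> [set phi s | s in l] \in singular_lines.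

Definition induces (g : {perm antiflag}) (phi : {perm sing_point}) : Prop :=
  forall s : sing_point,
    pencil (phi s) = [set [set g a | a in c] | c : {set antiflag} in pencil s].

Lemma adj1_sym : symmetric adj1.
Proof. by move=> a b; rewrite /adj1 eq_sym orbC. Qed.

Lemma adj1_irr : irreflexive adj1.
Proof. by move=> a; rewrite /adj1 eqxx. Qed.

End AntiFlags.

Record sgraph := SGraph {
  vertex :> finType;
  edge : rel vertex;
  edge_sym : symmetric edge;
  edge_irr : irreflexive edge }.

Definition Gamma1 (n : nat) : sgraph :=
  @SGraph (antiflag n : finType) (@adj1 n) (@adj1_sym n) (@adj1_irr n).

Definition graph_iso (G G' : sgraph) (h : G -> G') : Prop :=
  bijective h /\ forall a b : G, edge (h a) (h b) = edge a b.

Record geometry (X : finType) := Geometry {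
  gpoints : {set X};
  glines : {set {set X}} }.

(* A construction, from an arbitrary finite simple graph, of a point-line
   geometry whose points are sets of vertex sets. *)
Definition construction : Type :=
  forall G : sgraph, geometry {set {set G}}.

(* The action of a map of vertices on sets of vertex sets. *)
Definition transport (G G' : sgraph) (h : G -> G') (p : {set {set G}})
  : {set {set G'}} := [set [set h a | a in c] | c : {set G} in p].

(* The construction depends on nothing but the graph structure. *)
Definition iso_invariant (R : construction) : Prop :=
  forall (G G' : sgraph) (h : G -> G'), graph_iso h ->
    gpoints (R G') = [set transport h p | p in gpoints (R G)] /\
    glines (R G') =
      [set [set transport h p | p in l] | l : {set {set {set G}}} in glines (R G)].

(* The geometry (S, L) is recovered from G when some isomorphism-invariant
   construction, applied to G, yields (S, L), the point s appearing as [code s].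
   Fixing [code] matters: the mere existence of an isomorphism onto (S, L) would
   hold for constructions unrelated to the way (S, L) and G are linked. *)
Definition recovered (G : sgraph) (S : finType) (L : {set {set S}})
    (code : S -> {set {set G}}) : Prop :=
  injective code /\
  exists R : construction, iso_invariant R /\
    gpoints (R G) = [set code s | s : S] /\
    glines (R G) = [set [set code s | s in l] | l : {set S} in L].

(* Main.v *)
(* Through [f] a vertex of the graph is a vector a of W with Q a = 1, and two
   vertices are adjacent exactly when B(a, b) = 1, where B is the polar form of
   Q. Hence the neighbourhoods of a and b differ in {u | B(u, a + b) = 1}. As
   n >= 3, the vectors with Q = 1 span W, so this set determines a + b. If a and
   b are distinct and non-adjacent, a + b is singular, and every singular vector
   arises in this way. A singular point is therefore a class of non-edges with
   the same symmetric difference of neighbourhoods, and <s>, <t>, <r> form a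
   singular line iff s <> t and the set attached to r is the symmetric
   difference of those attached to s and t (orthogonality of s and t is then
   automatic, since Q (s + t) = B(s, t)). *)

Require Import Defs.
From HB Require Import structures.
From mathcomp Require Import all_boot all_order all_algebra all_fingroup.

Set Implicit Arguments.
Unset Strict Implicit.
Unset Printing Implicit Defensive.

Import GRing.Theory.
Local Open Scope ring_scope.

(** * Reconstructing a geometry from an arbitrary graph *)

Definition symdiff (T : finType) (X Y : {set T}) : {set T} :=
  [set u | (u \in X) (+) (u \in Y)].

Definition nbr_diff (G : sgraph) (a b : G) : {set G} :=
  [set u | edge u a (+) edge u b].

Definition nonedges (G : sgraph) (X : {set G}) : {set {set G}} :=
  [set [set c.1; c.2] | c : G * G
    & [&& c.1 != c.2, ~~ edge c.1 c.2 & nbr_diff c.1 c.2 == X]].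

Definition nonedge_geometry : construction := fun G =>
  Geometry
    [set nonedges X | X : {set G} & nonedges X != set0]
    [set [set nonedges Z.1; nonedges Z.2; nonedges (symdiff Z.1 Z.2)]
      | Z : {set G} * {set G}
      & [&& Z.1 != Z.2, nonedges Z.1 != set0, nonedges Z.2 != set0
          & nonedges (symdiff Z.1 Z.2) != set0]].

(** Each ingredient commutes with taking images under [h]. Since [h] is onto, [imK] writes every
    vertex set of [G'] as such an image, so these identities cover all points and lines of [G']. *)
Lemma nonedge_geometry_invariant : iso_invariant nonedge_geometry.
Proof.
move=> G G' h [[h' hK h'K] hE].
have hI : injective h := can_inj hK.
have nbr_diffE (a b : G) : nbr_diff (h a) (h b) = h @: nbr_diff a b.
  by apply/setP=> u; rewrite -[u]h'K mem_imset // !inE !hE.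
have imK (X : {set G'}) : h @: (h' @: X) = X.
  by rewrite -imset_comp (eq_imset _ (g := id)) ?imset_id // => u /=; rewrite h'K.
have symdiffE (X Y : {set G}) : symdiff (h @: X) (h @: Y) = h @: symdiff X Y.
  by apply/setP=> u; rewrite -[u]h'K mem_imset // !inE !mem_imset.
have nonedgesE (X : {set G}) : nonedges (h @: X) = transport h (nonedges X).
  apply/setP=> c; apply/imsetP/imsetP=> [[[a b]]|[d /imsetP[[a b]]]];
    rewrite inE /= => /and3P[ab nab].
    rewrite -[a]h'K -[b]h'K nbr_diffE (inj_eq (imset_inj hI)) => abX ->.
    exists [set h' a; h' b]; last by rewrite imsetU1 imset_set1.
    apply/imsetP; exists (h' a, h' b) => //.
    by rewrite inE /= abX -hE !h'K nab (inj_eq (can_inj h'K)) ab.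
  move=> abX -> ->; exists (h a, h b); last by rewrite imsetU1 imset_set1.
  by rewrite inE /= (inj_eq hI) ab hE nab nbr_diffE (inj_eq (imset_inj hI)).
have nonedges0 (X : {set G}) : (nonedges (h @: X) != set0) = (nonedges X != set0).
  by rewrite nonedgesE imset_eq0.
split; apply/setP=> P.
  apply/imsetP/imsetP=> [[X]|[p /imsetP[X]]].
    rewrite inE -[X]imK nonedges0 => X0 ->.
    by exists (nonedges (h' @: X)); rewrite ?nonedgesE // imset_f // inE.
  rewrite inE => X0 -> ->; exists (h @: X); rewrite ?nonedgesE //.
  by rewrite inE nonedges0.
have lineE (X Y : {set G}) :
    [set nonedges (h @: X); nonedges (h @: Y);
         nonedges (symdiff (h @: X) (h @: Y))] =
    [set transport h p
      | p in [set nonedges X; nonedges Y; nonedges (symdiff X Y)]].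
  by rewrite symdiffE !nonedgesE imsetU imsetU1 !imset_set1.
have condE (X Y : {set G}) :
    [&& h @: X != h @: Y, nonedges (h @: X) != set0, nonedges (h @: Y) != set0
      & nonedges (symdiff (h @: X) (h @: Y)) != set0] =
    [&& X != Y, nonedges X != set0, nonedges Y != set0
      & nonedges (symdiff X Y) != set0].
  by rewrite symdiffE !nonedges0 (inj_eq (imset_inj hI)).
apply/imsetP/imsetP=> [[[X Y]]|[p /imsetP[[X Y]]]].
  rewrite inE /= -[X]imK -[Y]imK condE lineE => XY ->.
  eexists; last by [].
  by apply/imsetP; exists (h' @: X, h' @: Y); rewrite ?inE.
rewrite inE /= => XY -> ->; exists (h @: X, h @: Y); last by rewrite lineE.
by rewrite inE /= condE.
Qed.

(** Invariance applied to [g] as an isomorphism from [G] to itself shows that [transport g]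
    preserves the coded points and the coded lines. Injectivity of [code] pulls this action back to
    [S]. *)
Lemma recovered_aut (G : sgraph) (S : finType) (L : {set {set S}})
    (code : S -> {set {set G}}) (g : {perm G}) :
  recovered L code -> (forall a b : G, edge (g a) (g b) = edge a b) ->
  exists phi : {perm S},
    (forall l, l \in L -> [set phi s | s in l] \in L) /\
    (forall s, code (phi s) = transport g (code s)).
Proof.
move=> [codeI [R [Rinv [RS RL]]]] gE.
have [] := Rinv _ _ (g : G -> G) (conj (injF_bij (@perm_inj _ g)) gE); rewrite RS RL => gS gL.
have img s : exists t, code t == transport g (code s).
  have : transport g (code s) \in [set code t | t : S].
    by rewrite gS; apply: imset_f; apply: imset_f.
  by case/imsetP=> t _ ->; exists t.
pose phi0 s := xchoose (img s).
have phi0E s : code (phi0 s) = transport g (code s).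
  exact/eqP/(xchooseP (img s)).
have phi0I : injective phi0.
  move=> s t /(congr1 code); rewrite !phi0E => st.
  by apply: codeI; apply: imset_inj st; apply: imset_inj perm_inj.
exists (perm phi0I); split=> [l lL|s]; last by rewrite permE.
have : [set transport g p | p in code @: l] \in [set code @: l | l : {set S} in L].
  by rewrite gL; apply: imset_f; apply: imset_f.
rewrite -imset_comp (eq_imset (g := code \o phi0)); last first.
  by move=> s /=; rewrite phi0E.
rewrite imset_comp => /imsetP[l' l'L /(imset_inj codeI)].
by rewrite (eq_imset (g := phi0)) => [->|s] //; rewrite permE.
Qed.

(** * Vectors over the field with two elements *)

Lemma F2_add_neq0 (k l : 'F_2) : (k + l != 0) = (k != 0) (+) (l != 0).
Proof.
have [->|/F2_neq0->] := eqVneq k 0; first by rewrite add0r.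
by have [->|/F2_neq0->] := eqVneq l 0; rewrite ?addr0.
Qed.

Lemma F2_addkk (k : 'F_2) : k + k = 0.
Proof. by have [->|/F2_neq0->] := eqVneq k 0; apply: val_inj. Qed.

Lemma addvv (U : lmodType 'F_2) (u : U) : u + u = 0.
Proof. by rewrite -[u]scale1r -scalerDl F2_addkk scale0r. Qed.

(** A point is the set of 0 and one nonzero vector, so summation recovers that vector without a
    choice; [svec] and [vec] rest on this. *)
Lemma pspan_sum (U : finLmodType 'F_2) (u : U) : \sum_(w in pspan u) w = u.
Proof.
have [->|u0] := eqVneq u 0; first by rewrite pspanE setUid big_set1.
by rewrite pspanE big_setU1 ?big_set1 /= ?add0r // inE eq_sym.
Qed.

Lemma join_pspan (U : finLmodType 'F_2) (u v : U) :
  join (pspan u) (pspan v) = [set 0; u; v; u + v].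
Proof.
rewrite !pspanE; apply/setP=> w; rewrite !inE; apply/imset2P/idP.
  case=> a b; rewrite !inE => /orP[]/eqP-> /orP[]/eqP-> ->;
    by rewrite ?addr0 ?add0r eqxx ?orbT.
rewrite -!orbA => /or4P[]/eqP->.
- by exists 0 0; rewrite ?inE ?eqxx ?addr0.
- by exists u 0; rewrite ?inE ?eqxx ?orbT ?addr0.
- by exists 0 v; rewrite ?inE ?eqxx ?orbT ?add0r.
- by exists u v; rewrite ?inE ?eqxx ?orbT.
Qed.

(** * Anti-flags, singular points and singular lines in terms of vectors of [W] *)

Section Vectors.
Variable n : nat.
Notation V := 'rV['F_2]_n.
Notation Vd := 'cV['F_2]_n.
Notation W := (V * Vd)%type.
Implicit Types (a b c : antiflag n) (s t : sing_point n) (v w : W).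

Definition B v w : 'F_2 := app w.2 v.1 + app v.2 w.1.

Lemma BDr u v w : B u (v + w) = B u v + B u w.
Proof. by rewrite /B /app /= mulmxDl mulmxDr !mxE addrACA. Qed.

Lemma BC v w : B v w = B w v.
Proof. by rewrite /B addrC. Qed.

Lemma QD v w : Q (v + w) = Q v + Q w + B v w.
Proof.
rewrite /Q /B /app /= mulmxDl !mulmxDr !mxE -!addrA; congr (_ + _).
by rewrite addrA addrC.
Qed.

Definition svec s : W := \sum_(w in val s) w.

Lemma f_surj a : exists u, a == f u.
Proof. by have [g _ gK] := @f_bij n; exists (g a); rewrite gK. Qed.

(* Kept opaque: otherwise comparing [vec a] with [vec b] makes unification
   compute with finite sets. *)
Lemma vec_subproof :
  {vec : antiflag n -> W | forall u, vec (f u) = \sum_(w in val u) w}.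
Proof.
exists (fun a => \sum_(w in val (xchoose (f_surj a))) w) => u.
by have /eqP/(bij_inj (@f_bij n))<- := xchooseP (f_surj (f u)).
Qed.

Definition vec : antiflag n -> W := sval vec_subproof.

Lemma svecP s : [/\ val s = pspan (svec s), svec s != 0 & Q (svec s) = 0].
Proof.
have /existsP[w /and3P[w0 /eqP sw /eqP Qw]] := valP s.
by rewrite /svec sw pspan_sum.
Qed.

Lemma svec_inj : injective svec.
Proof.
move=> s t st; apply: val_inj.
by have [-> _ _] := svecP s; have [-> _ _] := svecP t; rewrite st.
Qed.

Lemma svec_surj w : w != 0 -> Q w = 0 -> exists s, svec s = w.
Proof.
move=> w0 Qw; have sw : singular (pspan w).
  by apply/existsP; exists w; rewrite w0 Qw !eqxx.
by exists (exist (fun p => singular p) _ sw); rewrite /svec /= pspan_sum.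
Qed.

Lemma vec_f (u : nonsing_point n) : vec (f u) = \sum_(w in val u) w.
Proof. exact: (svalP vec_subproof). Qed.

Lemma nonsing_pspan (u : nonsing_point n) : val u = pspan (vec (f u)).
Proof.
by rewrite vec_f; have /nonsingularP[w -> _] := valP u; rewrite pspan_sum.
Qed.

Lemma Q_vec a : Q (vec a) = 1.
Proof.
have [u /eqP->] := f_surj a; rewrite vec_f.
by have /nonsingularP[w -> Qw] := valP u; rewrite pspan_sum.
Qed.

Lemma vec_inj : injective vec.
Proof.
move=> a b; have [u /eqP->] := f_surj a; have [u' /eqP->] := f_surj b => uu'.
by congr f; apply: val_inj; rewrite !nonsing_pspan uu'.
Qed.

Lemma vec_surj w : Q w = 1 -> exists a, vec a = w.
Proof.
move=> Qw; have ns : nonsingular (pspan w) by apply/nonsingularP; exists w.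
by exists (f (exist (fun p => nonsingular p) _ ns)); rewrite vec_f pspan_sum.
Qed.

Lemma val_antiflag a :
  (val a).1 = pspan (vec a).1 /\ (val a).2 = fker (vec a).2.
Proof.
have [u /eqP->] := f_surj a.
rewrite [val (f u)](_ : _ = fmap (val u)) // nonsing_pspan.
by case: (vec _) => x y; rewrite fmap_pspan.
Qed.

(** Adjacency means that exactly one of the two cross incidences holds, that is, exactly one of the
    two summands of [B] vanishes. For equal anti-flags the summands cancel. *)
Lemma adj1_vec a b : Defs.adj1 a b = (B (vec a) (vec b) != 0).
Proof.
have [a1 a2] := val_antiflag a; have [b1 b2] := val_antiflag b.
rewrite /Defs.adj1 a1 a2 b1 b2 !pspan_sub_fker /B.
have [->|_] := eqVneq a b; first by rewrite F2_addkk eqxx.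
by rewrite F2_add_neq0 /=; do 2!case: eqP.
Qed.

Lemma vec_add_neq0 a b : (vec a + vec b != 0) = (a != b).
Proof.
have [->|ab] := eqVneq a b; first by rewrite addvv eqxx.
apply: contra ab => /eqP ab; apply/eqP/vec_inj.
by rewrite -[LHS]addr0 -(addvv (vec b)) addrA ab add0r.
Qed.

Lemma Q_vec_add a b : Q (vec a + vec b) = B (vec a) (vec b).
Proof. by rewrite QD !Q_vec F2_addkk add0r. Qed.

Definition nonperp w : {set antiflag n} := [set c | B (vec c) w != 0].

Lemma nonperpD v w : nonperp (v + w) = symdiff (nonperp v) (nonperp w).
Proof. by apply/setP=> c; rewrite !inE BDr F2_add_neq0. Qed.

Lemma nbr_diff_vec a b :
  nbr_diff (G := Gamma1 n) a b = nonperp (vec a + vec b).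
Proof. by apply/setP=> c; rewrite !inE BDr F2_add_neq0 /= !adj1_vec. Qed.

(** The nonzero vectors on the join of two non-singular points are their vectors and the sum of
    these; only the sum can be singular. Distinctness of the two points follows from
    [svec s != 0]. *)
Lemma pencil_vec s :
  pencil s =
  [set [set c.1; c.2] | c : antiflag n * antiflag n & vec c.1 + vec c.2 == svec s].
Proof.
have [sE s0 Qs] := svecP s.
have svec_vec a : (svec s == vec a) = false.
  by apply/eqP=> sa; move/eqP: Qs; rewrite sa Q_vec.
have joinE (u u' : nonsing_point n) :
    (val s \subset join (val u) (val u')) = (vec (f u) + vec (f u') == svec s).
  rewrite sE !nonsing_pspan join_pspan pspanE subUset !sub1set !inE eqxx /=.
  by rewrite (negPf s0) !svec_vec eq_sym.
apply/setP=> A; apply/imsetP/imsetP=> [[[u u']]|[[a b]]]; rewrite inE /=.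
  by case/andP=> _; rewrite joinE => ss ->; exists (f u, f u'); rewrite ?inE.
have [u /eqP->] := f_surj a; have [u' /eqP->] := f_surj b => ss ->.
exists (u, u') => //; rewrite inE /= joinE ss andbT.
by rewrite -(inj_eq (bij_inj (@f_bij n))) -vec_add_neq0 (eqP ss).
Qed.

Lemma singular_linesP (l : {set sing_point n}) :
  reflect (exists s t r, [/\ s != t, svec r = svec s + svec t & l = [set s; t; r]])
          (l \in singular_lines n).
Proof.
apply: (iffP imsetP) => [[m + ->]|[s [t [r [st rst ->]]]]].
  rewrite inE => /andP[/existsP[p /existsP[q]]].
  case/and4P=> /existsP[u /andP[u0 /eqP->]] /existsP[v /andP[v0 /eqP->]] uv /eqP->.
  have {}uv : u != v by apply: contra uv => /eqP->.
  rewrite join_pspan => /forallP sing.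
  (* Each nonzero vector of the line spans a point contained in it, which is singular by
     assumption. *)
  have getpt w : w != 0 -> w \in [set 0; u; v; u + v] -> exists s, svec s = w.
    move=> w0 wl; apply: svec_surj => //.
    have := sing (pspan w); rewrite pspanE subUset !sub1set wl !inE eqxx /=.
    rewrite -pspanE /= andbT.
    have -> : is_point (pspan w) by apply/existsP; exists w; rewrite w0 eqxx.
    by case/existsP=> w' /and3P[_ /eqP/pspan_inj<- /eqP].
  have uv0 : u + v != 0.
    by apply: contra uv => /eqP uv; rewrite -[u]addr0 -(addvv v) addrA uv add0r.
  have [s su] : exists s, svec s = u by apply: getpt; rewrite // !inE eqxx ?orbT.
  have [t tv] : exists s, svec s = v by apply: getpt; rewrite // !inE eqxx ?orbT.
  have [r ruv] : exists s, svec s = u + v by apply: getpt; rewrite // !inE eqxx ?orbT.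
  exists s, t, r; split; rewrite ?su ?tv //.
    by rewrite -(inj_eq svec_inj) su tv.
  apply/setP=> x; have [xE x0 _] := svecP x.
  rewrite !inE xE pspanE subUset !sub1set !inE eqxx /= (negPf x0) /=.
  by rewrite -!(inj_eq svec_inj) su tv ruv.
have [sE s0 Qs] := svecP s; have [tE t0 Qt] := svecP t; have [rE r0 Qr] := svecP r.
exists (join (val s) (val t)).
  rewrite inE; apply/andP; split.
    apply/existsP; exists (val s); apply/existsP; exists (val t).
    apply/and4P; split; last exact: eqxx.
    - by apply/existsP; exists (svec s); rewrite s0 sE /=.
    - by apply/existsP; exists (svec t); rewrite t0 tE /=.
    - by rewrite (inj_eq val_inj).
  (* The nonzero vectors of the join belong to [s], [t] and [r], all of them singular. *)
  apply/forallP=> p; apply/implyP=> /andP[/existsP[w /andP[w0 /eqP->]]].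
  rewrite sE tE join_pspan [pspan w]pspanE subUset !sub1set !inE eqxx (negPf w0) /=.
  rewrite -rst -pspanE => wE; apply/existsP; exists w; rewrite w0 eqxx /=.
  by case/orP: wE => [/orP[]|] /eqP->; apply/eqP.
apply/setP=> x; have [xE x0 _] := svecP x.
rewrite !inE xE sE tE join_pspan pspanE subUset !sub1set !inE eqxx (negPf x0) /=.
by rewrite -!(inj_eq svec_inj) rst.
Qed.

(** * Recovering singular vectors from neighbourhoods when n is at least 3 *)

Hypothesis n_ge3 : (3 <= n)%N.

(** For w = (x, y), containment of ker y in the span of x would give n <= rank y + rank x <= 2. So
    some x' in ker y lies outside that span, and some functional y' kills x but not x'; take (x',
    y'). *)
Lemma exists_nonsing_perp w : exists a, B (vec a) w = 0.
Proof.
case: w => x y.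
have : ~~ (kermx y <= x)%MS.
  apply/negP=> /mxrankS; rewrite mxrank_ker leq_subLR => le_n.
  have := leq_trans n_ge3 (leq_trans le_n (leq_add (rank_leq_col y) (rank_leq_row x))).
  by [].
case/row_subPn=> i; set x' := row i _ => x'x.
have yx' : x' *m y = 0 by rewrite -row_mul mulmx_ker row0.
move: x'x; rewrite submxE => /rV0Pn[j x'j].
(* The columns of [cokermx x] are functionals vanishing on x; column j is one that is nonzero at
   x'. *)
pose y' := col j (cokermx x).
have y'x : x *m y' = 0 by rewrite /y' colE mulmxA mulmx_coker mul0mx.
have Q' : Q ((x', y') : W) = 1.
  by apply: F2_neq0; rewrite /Q /app /= /y' colE mulmxA -colE mxE.
have [a aE] := vec_surj Q'; exists a.
by rewrite aE /B /app /= yx' y'x !mxE addr0.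
Qed.

(** If [vec a] is orthogonal to the singular vector w, then Q (vec a + w) = 1 + 0 + 0, so
    [vec a + w] is again the vector of an anti-flag. *)
Lemma nonsing_split w : Q w = 0 -> exists a b, vec a + vec b = w.
Proof.
move=> Qw; have [a aw] := exists_nonsing_perp w.
have [b bE] : exists b, vec b = vec a + w.
  by apply: vec_surj; rewrite QD Q_vec Qw aw !addr0.
by exists a, b; rewrite bE addrA addvv add0r.
Qed.

(** The vector v + w is orthogonal to every [vec c], hence by [nonsing_split] to every singular
    vector, and these span [W]. *)
Lemma nonperp_inj : injective nonperp.
Proof.
move=> v w vw.
have perp c : B (vec c) (v + w) = 0.
  have: c \notin nonperp (v + w) by rewrite nonperpD vw inE addbb.
  by rewrite inE negbK => /eqP.
have {}perp u : Q u = 0 -> B (v + w) u = 0.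
  by case/nonsing_split=> a [b <-]; rewrite BDr ![B (v + w) _]BC !perp addr0.
rewrite -[v]addr0 -(addvv w) addrA -[RHS]add0r; congr (_ + _).
(* The vectors (0, e_i) and (e_i, 0) are singular, and pairing with them reads off the coordinates
   of x and y. *)
case: (v + w) perp => x y perp; congr (_, _).
  apply/rowP=> i; have := perp (0, delta_mx i 0).
  by rewrite /Q /B /app /= !mul0mx -colE !mxE addr0 => ->.
apply/colP=> i; have := perp (delta_mx 0 i, 0).
by rewrite /Q /B /app /= !mulmx0 -rowE !mxE add0r => ->.
Qed.

(** By [nonperp_inj] both sides select the pairs with vector sum [svec s]. Such a pair is
    automatically distinct, as the sum is nonzero, and non-adjacent, as B (vec a) (vec b) = Q (svec
    s) = 0. *)
Lemma pencil_nonedges s : pencil s = nonedges (G := Gamma1 n) (nonperp (svec s)).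
Proof.
have [_ s0 Qs] := svecP s; rewrite pencil_vec /nonedges.
apply: (congr1 (fun C : {set antiflag n * antiflag n} =>
  [set [set c.1; c.2] | c in C])).
apply/setP=> -[a b]; rewrite !inE nbr_diff_vec (inj_eq nonperp_inj) /= adj1_vec negbK.
have [ss|_] := eqVneq (vec a + vec b) (svec s); last by rewrite !andbF.
by rewrite -vec_add_neq0 -Q_vec_add ss s0 Qs eqxx.
Qed.

Lemma pencil_neq0 s : pencil s != set0.
Proof.
have [_ _ Qs] := svecP s; have [a [b ab]] := nonsing_split Qs.
apply/set0Pn; exists [set a; b]; rewrite pencil_vec.
by apply/imsetP; exists (a, b); rewrite // inE /= ab.
Qed.

(** A single member of a pencil already determines the singular point, which gives [pencil_inj]. *)
Lemma sum_pencil s A : A \in pencil s -> \sum_(c in A) vec c = svec s.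
Proof.
have [_ s0 _] := svecP s.
rewrite pencil_vec => /imsetP[[a b]]; rewrite inE /= => /eqP ab ->.
by rewrite big_setU1 ?big_set1 //= inE -vec_add_neq0 ab.
Qed.

Lemma pencil_inj : injective (@pencil n).
Proof.
move=> s t st; have /set0Pn[A As] := pencil_neq0 s.
by apply: svec_inj; rewrite -(sum_pencil As); apply: sum_pencil; rewrite -st.
Qed.

(** The vectors of a non-edge sum to a nonzero vector, singular because Q of the sum is B of the
    pair. *)
Lemma nonedges_neq0 X : nonedges (G := Gamma1 n) X != set0 ->
  exists s, X = nonperp (svec s).
Proof.
case/set0Pn=> A /imsetP[[a b]].
rewrite inE nbr_diff_vec /= adj1_vec negbK.
case/and3P=> ab Qab /eqP<- _.
have [s sE] : exists s, svec s = vec a + vec b.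
  by apply: svec_surj; rewrite ?vec_add_neq0 // Q_vec_add; apply/eqP.
by exists s; rewrite sE.
Qed.

Lemma recovered_polar_space :
  recovered (G := Gamma1 n) (singular_lines n) (@pencil n).
Proof.
split; first exact: pencil_inj.
exists nonedge_geometry; split; first exact: nonedge_geometry_invariant.
split; apply/setP=> P.
  apply/imsetP/imsetP=> [[X]|[s _ ->]].
    rewrite inE => X0 ->; have [s sE] := nonedges_neq0 X0.
    by exists s; rewrite // pencil_nonedges sE.
  by exists (nonperp (svec s)); rewrite ?inE -pencil_nonedges ?pencil_neq0.
apply/imsetP/imsetP=> [[[X Y]]|[l]].
  rewrite inE /= => /and4P[XY X0 Y0 XY0] ->.
  have [s sE] := nonedges_neq0 X0; have [t tE] := nonedges_neq0 Y0.
  have [r rE] := nonedges_neq0 XY0.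
  exists [set s; t; r].
    apply/singular_linesP; exists s, t, r; split=> //.
      by apply: contra XY => /eqP st; rewrite sE tE st.
    (* Symmetric difference of sets is addition of vectors under [nonperp], so injectivity turns the
       set identity into r = s + t. *)
    by apply: nonperp_inj; rewrite nonperpD -rE sE tE.
  by rewrite imsetU imsetU1 !imset_set1 !pencil_nonedges -rE -sE -tE.
case/singular_linesP=> s [t [r [st rst ->]]] ->.
exists (nonperp (svec s), nonperp (svec t)).
  rewrite inE /= -nonperpD -rst -!pencil_nonedges !pencil_neq0 !andbT.
  by rewrite (inj_eq nonperp_inj) (inj_eq svec_inj).
by rewrite /= -nonperpD -rst -!pencil_nonedges imsetU imsetU1 !imset_set1.
Qed.

End Vectors.

Local Close Scope ring_scope.

Theorem theorem2 (n : nat) (hn : 3 <= n) :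
  recovered (G := Gamma1 n) (singular_lines n) (@pencil n) /\
  (forall g : {perm (antiflag n)}, graph_aut g ->
     exists phi : {perm (sing_point n)}, polar_aut phi /\ induces g phi).
Proof.
have rec := recovered_polar_space hn; split=> // g gE.
(* With [pencil] as the code, [induces] unfolds to the intertwining identity of [recovered_aut]. *)
exact: (recovered_aut rec gE).
Qed.
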